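(* Suppose that $Z\neq\varnothing$. Then $$Z=U\cap(v+\operatorname{dom}\partial g)\cap\operatorname{argmin}\big(\iota_U+g(\cdot-v)\big)=\operatorname{argmin}\big(\iota_U+g(\cdot-v)\big).$$
   Context: $X$ is a real Hilbert space with inner product $\langle\cdot,\cdot\rangle$ and norm $\|\cdot\|$; $U$ is a closed linear subspace of $X$; $g\colon X\to\,]-\infty,+\infty]$ is convex, lower semicontinuous and proper, with $\operatorname{dom}g=\{x: g(x)<+\infty\}$, subdifferential $\partial g$, $\operatorname{dom}\partial g=\{x:\partial g(x)\ne\varnothing\}$, and Fenchel conjugate $g^*$. $\iota_U$ is the indicator function of $U$ ($0$ on $U$, $+\infty$ off $U$). $N_U$ is the normal cone operator: $N_U(x)=U^\perp$ if $x\in U$, and $\varnothing$ otherwise. For a nonempty closed convex set $C$, $P_C$ is the projector onto $C$. $R_U=2P_U-\operatorname{Id}$. $\operatorname{Prox}_g(x)$ is the unique minimizer of $z\mapsto g(z)+\tfrac12\|x-z\|^2$. $T=\operatorname{Id}-P_U+\operatorname{Prox}_gR_U$ is the Douglas--Rachford operator. The minimal displacement vector is $v=P_{\overline{\operatorname{ran}}(\operatorname{Id}-T)}(0)$. The set of normal solutions is $Z=\{x\in X: v\in N_U(x)+\partial g(x-v)\}$. Standing assumptions: (a) $Z\neq\varnothing$ (then $Z$ is closed and convex); (b) $P_Z$ is weak-to-weak continuous (automatic if $X$ is finite-dimensional); (c) $0\in U^\perp+\operatorname{dom}g^*$; (d) $v=P_{\overline{U-\operatorname{dom}g}}(0)$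 (automatic from (c) if $X$ is finite-dimensional). *)

(* Defs.v *)
From mathcomp Require Import all_boot all_order all_algebra.
From mathcomp Require Import all_classical all_reals all_analysis.
From mathcomp Require Export sesquilinear.

Set Implicit Arguments.
Unset Strict Implicit.
Unset Printing Implicit Defensive.

Import Order.TTheory GRing.Theory Num.Theory.
Import numFieldNormedType.Exports.

Local Open Scope classical_set_scope.
Local Open Scope ring_scope.

(* A real Hilbert space is a completeNormedModType X over R together with
   dot : {dot X for idfun} (symmetric, bilinear, positive definite) which
   induces the norm. *)
Definition induces_norm (R : realType) (X : completeNormedModType R)
    (dot : {dot X for idfun}) :=
  forall x : X, dot x x = `|x| ^+ 2.

Section Minimizers.
Context {R : realType} {X : completeNormedModType R}.
Implicit Types (C U : set X) (f g : X -> \bar R) (x : X).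
Local Open Scope ereal_scope.

Definition argmin f : set X := [set x | forall y, f x <= f y].

Definition indicator C x : \bar R := if x \in C then 0 else +oo.

(* The nearest point, which exists and is unique when C is nonempty, closed and
   convex; [get] yields an arbitrary default otherwise. *)
Definition projector C x : X :=
  get [set p | C p /\ forall c, C c -> (`|x - p| <= `|x - c|)%R].

Definition prox g x : X :=
  get (argmin (fun z => g z + (2^-1 * `|x - z| ^+ 2)%:E)).

Definition reflector C x : X := (2 *: projector C x - x)%R.

Definition dr_operator U g x : X :=
  (x - projector U x + prox g (reflector U x))%R.

Definition min_displacement U g : X :=
  projector (closure (range (fun x => x - dr_operator U g x)%R)) 0%R.

Definition dom f : set X := [set x | f x < +oo].

Definition proper_fun f := (forall x, -oo < f x) /\ dom f !=set0.

Definition convex_fun f := forall x y (t : R), (0 < t < 1)%R ->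
  f (t *: x + (1 - t) *: y)%R <= t%:E * f x + (1 - t)%:E * f y.

Definition closed_subspace U := submod_closed (mem U) /\ closed U.

End Minimizers.

Section HilbertNotions.
Context {R : realType} {X : completeNormedModType R} (dot : {dot X for idfun}).
Implicit Types (U : set X) (g : X -> \bar R) (x u : X).

Definition orthogonal_complement U : set X :=
  [set u | forall x, U x -> dot x u = 0].

Definition normal_cone U x : set X :=
  [set u | U x /\ orthogonal_complement U u].

(* For proper g this is empty as soon as g x = +oo. *)
Definition subdifferential g x : set X :=
  [set u | forall y, ((dot (y - x) u)%:E + g x <= g y)%E].

Definition dom_subdifferential g : set X :=
  [set x | subdifferential g x !=set0].

Definition conjugate g u : \bar R :=
  ereal_sup (range (fun x => ((dot x u)%:E - g x)%E)).

Definition normal_solutions U g : set X :=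
  let v := min_displacement U g in
  [set x | [set a + b | a in normal_cone U x
                      & b in subdifferential g (x - v)] v].

(* X with the coarsest topology making every x |-> dot x y continuous. *)
Definition weak_space :=
  initial_topology (fun x => dot x : prod_topology (fun=> R)).

Definition weak_weak_continuous (F : X -> X) :=
  continuous (F : weak_space -> weak_space).

End HilbertNotions.

(* Main.v *)
Require Import Defs.
From mathcomp Require Import all_boot all_order all_algebra.
From mathcomp Require Import all_classical all_reals all_analysis.
From mathcomp Require Import ring lra.
Import Order.TTheory GRing.Theory Num.Theory.
Import numFieldNormedType.Exports.

Local Open Scope classical_set_scope.
Local Open Scope ring_scope.

(** Everything rests on one fact: the displacement [v] is orthogonal to [U].
    By hypothesis [v] is the point of smallest norm in the closure of
    [U - dom g].  That closure is stable under translation by elements of the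
    subspace [U], so [v] minimizes the norm on [v + U], and the first-order
    condition along every line of [v + U] gives orthogonality
    ([projector_difference_orthogonal]).

    Now [x] lies in [Z] exactly when [x] is in [U] and [g] has at [x - v] a
    subgradient [b] with [v - b] orthogonal to [U].  As [v] is orthogonal to
    [U], so is [b]; hence the term [dot (y - x) b] of the subgradient
    inequality vanishes for [x] and [y] in [U].  This is used twice.  It says
    that [g (x - v) <= g (y - v)] for every [y] in [U], so [x] minimizes [f].
    Conversely, let [x] minimize [f] and let [z0] be the given point of [Z],
    with subgradient [b].  Then [f x = f z0] is finite, so [x] is in [U] and
    [g (x - v) = g (z0 - v)], and the affine minorant of [g] with slope [b]
    that touches [g] at [z0 - v] also touches it at [x - v]: [b] is a
    subgradient there too ([subdifferential_shift]), and [x] is in [Z].  Thus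
    [Z = argmin f], and points of [Z] lie in [U] and in [v + dom (partial g)]
    by the very definition of [Z].

    Since [projector] is a choice operator, its defining property has to be
    secured by the existence of nearest points, proved in [exists_nearest]
    from completeness and the parallelogram law. *)
Section Hilbert.
Set Implicit Arguments.
Unset Strict Implicit.
Context {R : realType} {X : completeNormedModType R} (dot : {dot X for idfun}).
Context (dot_norm : induces_norm dot).
Implicit Types (A C S U : set X) (g : X -> \bar R) (x y u : X).

Lemma dotC x y : dot x y = dot y x.
Proof. by rewrite hermC expr0 mul1r. Qed.

Lemma dotZr a x y : dot x (a *: y) = a * dot x y.
Proof. by rewrite linearZr. Qed.

Lemma dotZl a x y : dot (a *: x) y = a * dot x y.
Proof. by rewrite dotC dotZr dotC. Qed.

Lemma sqr_norm_subZ x y (t : R) :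
  `|x - t *: y| ^+ 2 = `|x| ^+ 2 - 2 * t * dot x y + t ^+ 2 * `|y| ^+ 2.
Proof.
by rewrite -!dot_norm linearBl !linearBr /= !dotZl !dotZr (dotC y x); ring.
Qed.

(** The parallelogram law for [x - y] and [x - z]: two points almost nearest to
    [x] whose midpoint is not nearer than the infimum are close together. *)
Lemma apollonius x y z :
  `|y - z| ^+ 2 = 2 * `|x - y| ^+ 2 + 2 * `|x - z| ^+ 2
                  - 4 * `|x - 2^-1 *: (y + z)| ^+ 2.
Proof.
rewrite -!dot_norm !linearBl !linearBr /= !dotZl !dotZr !linearDl !linearDr /=.
by rewrite (dotC y x) (dotC z x) (dotC z y); field.
Qed.

(** A minimizing sequence taken in [S] is Cauchy by [apollonius], and its limit
    realizes the infimum of the distances.  Working with [S] rather than with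
    its closure spares showing that midpoints stay in the closure. *)
Lemma exists_nearest S x : S !=set0 ->
    (forall y z, S y -> S z -> S (2^-1 *: (y + z))) ->
  exists p, closure S p /\ forall c, closure S c -> `|x - p| <= `|x - c|.
Proof.
move=> [s0 Ss0] Smid.
pose E := [set `|x - s| ^+ 2 | s in S].
have Elb : has_lbound E by exists 0 => _ [s _ <-]; exact: sqr_ge0.
have Einf : has_inf E by split => //; exists (`|x - s0| ^+ 2), s0.
pose D := inf E.
have DleS s : S s -> D <= `|x - s| ^+ 2.
  by move=> Ss; apply: ge_inf => //; exists s.
have ctsq : continuous (fun z : X => `|x - z| ^+ 2 : R).
  move=> z; apply: (continuous_comp (f := fun w : X => `|x - w|)
    (g := fun r : R => r ^+ 2)); last exact: exprn_continuous.
  by apply: cvg_norm; apply: cvgB; [exact: cvg_cst | exact: cvg_id].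
have /choice[s sP] n : exists s, S s /\ `|x - s| ^+ 2 < D + n.+1%:R^-1.
  have n0 : 0 < n.+1%:R^-1 :> R by rewrite invr_gt0.
  have [_ [s Ss <-] sD] := inf_adherent n0 Einf.
  by exists s.
have : cauchy (s @ \oo).
  apply: cauchy_exP => e e0.
  (* squared distances within e^2/4 of the infimum give 4 * (e^2/4) = e^2 in
     [apollonius] *)
  have e2 : 0 < e ^+ 2 / 4 by rewrite divr_gt0 ?exprn_gt0.
  have [N _ NP] := near_infty_natSinv_lt (PosNum e2).
  exists (s N); exists N => // n Nn /=.
  have near_inf k : (N <= k)%N -> `|x - s k| ^+ 2 < D + e ^+ 2 / 4.
    by move=> /NP/= ke; apply: lt_trans (sP k).2 _; rewrite ltrD2l.
  rewrite -ball_normE /= -(@ltr_pXn2r _ 2) ?nnegrE // ?ltW //.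
  rewrite (apollonius x (s N) (s n)).
  have := DleS _ (Smid _ _ (sP N).1 (sP n).1).
  have := near_inf _ (leqnn N); have := near_inf _ Nn.
  by clearbody D; lra.
move=> /cauchy_cvg /= sp; set p := lim _ in sp.
exists p; split.
  apply: (closed_cvg (u_ := s)) sp; first exact: closed_closure.
  by apply: nearW => n; apply: subset_closure; exact: (sP n).1.
have Dp : `|x - p| ^+ 2 <= D.
  apply/ler_addgt0Pr => e e0.
  apply: (closed_cvg (u_ := s) (fun z : X => `|x - z| ^+ 2 <= D + e)) sp.
    exact: (preimage_closed (fun z _ => ctsq z) (@closed_le _ _)).
  have := near_infty_natSinv_lt (PosNum e0); apply: filterS => n /= ne.
  by apply/ltW/(lt_trans (sP n).2); rewrite ltrD2l.
move=> c Sc; rewrite -(@ler_pXn2r _ 2) ?nnegrE //; apply: (le_trans Dp).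
have clD : closed [set z : X | D <= `|x - z| ^+ 2].
  exact: (preimage_closed (fun z _ => ctsq z) (@closed_ge _ _)).
by move: Sc; rewrite closureE => /(smallest_sub clD); apply => z; exact: DleS.
Qed.

Lemma projectorP S x : S !=set0 ->
    (forall y z, S y -> S z -> S (2^-1 *: (y + z))) ->
  closure S (projector (closure S) x) /\
  forall c, closure S c -> `|x - projector (closure S) x| <= `|x - c|.
Proof. by move=> S0 Smid; apply: (getPex (exists_nearest x S0 Smid)). Qed.

(** First-order optimality: [t |-> `|x - (p + t *: u)| ^+ 2] is a quadratic
    polynomial that is minimal at [t = 0], so its linear term vanishes. *)
Lemma nearest_sub_orthogonal C u x p : (forall t : R, C (p + t *: u)) ->
  (forall c, C c -> `|x - p| <= `|x - c|) -> dot (x - p) u = 0.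
Proof.
move=> Cpu pmin; set w := x - p; set d := dot w u.
have quad (t : R) : 2 * t * d <= t ^+ 2 * `|u| ^+ 2.
  have := pmin _ (Cpu t); rewrite -(@ler_pXn2r _ 2) ?nnegrE // opprD addrA.
  by rewrite sqr_norm_subZ -/d -/w; lra.
have [u0|u0] := eqVneq u 0; first by rewrite /d u0 linear0r.
have : 0 < `|u| ^+ 2 by rewrite exprn_gt0 ?normr_gt0.
(* [d / q] minimizes the quadratic polynomial, with value [- d ^+ 2 / q] *)
move: (`|u| ^+ 2) quad => q quad q0; have := quad (d / q).
have -> : 2 * (d / q) * d = 2 * (d ^+ 2 / q) by field; rewrite gt_eqF.
have -> : (d / q) ^+ 2 * q = d ^+ 2 / q by field; rewrite gt_eqF.
move=> dq; have : d ^+ 2 / q <= 0 by lra.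
by rewrite ler_pdivrMr // mul0r exprn_even_le0 // => /eqP.
Qed.

Lemma closure_add A u : (forall a, A a -> A (a + u)) ->
  forall a, closure A a -> closure A (a + u).
Proof.
move=> AU a Aa.
have clA : closed [set z : X | closure A (z + u)].
  apply: (preimage_closed (f := fun z : X => z + u)); last first.
    exact: closed_closure.
  by move=> z _; apply: cvgD; [exact: cvg_id | exact: cvg_cst].
have : A `<=` [set z : X | closure A (z + u)].
  by move=> z Az; apply: subset_closure; exact: AU.
by move/(smallest_sub clA); rewrite -closureE; apply.
Qed.

(** The affine minorant with slope [b] exact at [x] takes the same value at [x]
    and [y] when [y - x] is orthogonal to [b]; as [g] does too, it is exact at
    [y] as well. *)
Lemma subdifferential_shift g x y b : dot (y - x) b = 0 -> g y = g x ->
  subdifferential dot g x b -> subdifferential dot g y b.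
Proof.
move=> + gyx bx z; have := bx z; rewrite gyx !linearBl /=.
by move=> + /subr0_eq ->.
Qed.

Lemma dom_midpoint g : convex_fun g ->
  forall y z, dom g y -> dom g z -> dom g (2^-1 *: (y + z)).
Proof.
move=> gcvx y z /= gy gz; rewrite scalerDr.
have h : 0 < (2^-1 : R) < 1 by lra.
have := gcvx y z _ h; have -> : 1 - 2^-1 = 2^-1 :> R by lra.
move=> /le_lt_trans; apply; apply: lte_add_pinfty.
  by apply: lte_mul_pinfty => //; rewrite lee_fin; lra.
by apply: lte_mul_pinfty => //; rewrite lee_fin; lra.
Qed.

(** [U - dom g] is stable under midpoints because [g] is convex, which makes the
    projection exist, and under translation by [U], which makes the whole of
    [v + U] available as competitors in the minimization of the norm. *)
Lemma projector_difference_orthogonal U g : submod_closed (mem U) ->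
    convex_fun g -> dom g !=set0 ->
  orthogonal_complement dot U
    (projector (closure [set u - y | u in U & y in dom g]) 0).
Proof.
move=> [/set_mem U0 Ulin] gcvx [y0 gy0].
have UD a u w : U u -> U w -> U (a *: u + w).
  by move=> Uu Uw; apply/set_mem/Ulin; exact/mem_set.
set S := [set u - y | u in U & y in dom g].
have Smid y z : S y -> S z -> S (2^-1 *: (y + z)).
  move=> [u Uu [y' gy' <-]] [w Uw [z' gz' <-]].
  exists (2^-1 *: (u + w)).
    have := UD 2^-1 (u + w) 0; rewrite addr0; apply => //.
    by rewrite -[u]scale1r; exact: UD.
  exists (2^-1 *: (y' + z')); first exact: dom_midpoint.
  by rewrite -scalerBr addrACA opprD.
have S0 : S !=set0 by exists (0 - y0), 0 => //; exists y0.
have [vS vmin] := projectorP 0 S0 Smid; set v := projector _ _ in vS vmin *.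
move=> u Uu.
have : dot (0 - v) u = 0.
  apply: nearest_sub_orthogonal vmin => t; apply: closure_add vS.
  move=> _ [w Uw [y gy <-]]; exists (t *: u + w); first exact: UD.
  by exists y => //; rewrite [RHS]addrC addrA.
by rewrite sub0r linearNl dotC => /eqP; rewrite oppr_eq0 => /eqP.
Qed.

End Hilbert.

Theorem theorem3p4 (R : realType) (X : completeNormedModType R)
    (dot : {dot X for idfun}) (dot_norm : induces_norm dot)
    (U : set X) (U_subspace : closed_subspace U)
    (g : X -> \bar R) (g_convex : convex_fun g)
    (g_lsc : lower_semicontinuous g) (g_proper : proper_fun g) :
  let v := min_displacement U g in
  let Z := normal_solutions dot U g in
  let f := fun x : X => (indicator U x + g (x - v)%R)%E in
  Z !=set0 ->
  weak_weak_continuous dot (projector Z) ->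
  [set a + b | a in orthogonal_complement dot U & b in dom (conjugate dot g)] 0 ->
  v = projector (closure [set u - y | u in U & y in dom g]) 0 ->
  Z = U `&` [set v + y | y in dom_subdifferential dot g] `&` argmin f /\
  U `&` [set v + y | y in dom_subdifferential dot g] `&` argmin f = argmin f.
Proof.
move=> v Z f [z0 Zz0] _ _ v_proj.
have [g_gtNy [y0 gy0]] := g_proper.
have vU : orthogonal_complement dot U v.
  rewrite v_proj; apply: projector_difference_orthogonal => //.
    exact: U_subspace.1.
  by exists y0.
have fU x : U x -> f x = g (x - v).
  by move=> Ux; rewrite /f /indicator mem_set // add0e.
have fNU x : ~ U x -> f x = +oo%E.
  by move=> nUx; rewrite /f /indicator memNset // addye // gt_eqF.
have diff_orth x z b : U x -> U z -> orthogonal_complement dot U (v - b) ->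
    dot (z - x) b = 0.
  move=> Ux Uz vb; have -> : b = v - (v - b) by rewrite subKr.
  by rewrite linearBr !linearBl /= !vb ?vU // !subrr.
have ZP x : Z x <-> exists b, [/\ U x,
    orthogonal_complement dot U (v - b) & subdifferential dot g (x - v) b].
  split=> [[a [Ux aU] [b bx abv]]|[b [Ux vb bx]]].
    by exists b; split=> //; rewrite /v -abv addrK.
  by exists (v - b) => //; exists b => //; rewrite subrK.
have argminZ x : Z x -> argmin f x.
  move=> /ZP[b [Ux vb bx]] z.
  have [Uz|/fNU ->] := pselect (U z); last exact: leey.
  rewrite !fU //; apply: le_trans (bx (z - v)).
  by rewrite opprB addrA subrK diff_orth // add0e.
have Zargmin x : argmin f x -> Z x.
  move=> xmin; have /ZP[b [Uz0 vb bz0]] := Zz0.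
  have fxz0 : f x = f z0 by apply/le_anti; rewrite xmin argminZ.
  have Ux : U x.
    (* otherwise [f z0 = f x = +oo], and the subgradient inequality at [z0 - v]
       forces [g] to be infinite everywhere *)
    apply: contrapT => /fNU fx; have := bz0 y0.
    rewrite -fU // -fxz0 fx addey // leye_eq => /eqP gy.
    by rewrite /dom /= gy ltxx in gy0.
  apply/ZP; exists b; split => //.
  apply: subdifferential_shift bz0; last by rewrite -!fU.
  by rewrite opprB addrA subrK diff_orth.
suff argminE : U `&` [set v + y | y in dom_subdifferential dot g] `&` argmin f =
    argmin f.
  by split=> //; rewrite argminE; apply/seteqP; split.
apply/seteqP; split=> [x []//|x xmin].
have /ZP[b [Ux _ bx]] := Zargmin _ xmin.
by split=> //; split=> //; exists (x - v); [exists b | rewrite subrKC].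
Qed.
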